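(* Let $w\ge 0$ be an integer, let $T\subset\mathbb{N}=\{1,2,\dots\}$ be finite, let $f$ be a fixed monic polynomial over $\mathbb{F}_q$, let $m\ge 0$ be an integer, and let $r_i\ge 0$ be integers for $i\in T$. Let $N(m,\prod_{i\in T}I_i^{r_i},\langle f\rangle)$ be the number of monic polynomials $g$ over $\mathbb{F}_q$ of degree $m$ with $\langle g\rangle=\langle f\rangle$ such that, for each $i\in T$, $g$ has exactly $r_i$ distinct monic irreducible factors of degree $i$. Then $$N\Big(m,\prod_{i\in T}I_i^{r_i},\langle f\rangle\Big)=q^{m-w}\sum_{(j_i)_{i\in T}}\mathbf{1}\Big[\sum_{i\in T}i(r_i+j_i)\le m\Big]\prod_{i\in T}\binom{|I_i|}{r_i}q^{-ir_i}q^{-ij_i}\binom{|I_i|-r_i}{j_i}(-1)^{j_i}$$ $$\qquad+\Big[\langle f\rangle z^m\prod_{i\in T}u_i^{r_i}\Big]\;J\Big(\sum_{d=0}^{w-1}\sum_{h\in M_d}\langle h\rangle z^d\Big)\prod_{i\in T}\prod_{g\in I_i}\big(1+\langle g\rangle z^i(u_i-1)\big),$$ where the first sum runs over all tuples $(j_i)_{i\in T}$ of integers with $0\le j_i\le |I_i|-r_i$ (it is empty if some $r_i>|I_i|$).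
   Context: $\mathbb{F}_q$ is a finite field with $q=p^e$ elements, $p$ prime, $e\ge1$. $M$ is the set of monic polynomials over $\mathbb{F}_q$, $M_d$ the set of those of degree $d$, and $I_i$ the set of monic irreducible polynomials of degree $i$ over $\mathbb{F}_q$. For $f\in M$ of degree $d(f)$ write $f=x^{d(f)}+f_1x^{d(f)-1}+\cdots+f_{d(f)}$ and set $f_j=0$ for $j>d(f)$. For the fixed integer $w\ge0$, $\langle f\rangle$ denotes $x^{d(f)}f(1/x) \bmod x^{w+1}$, i.e. the class of $1+f_1x+\cdots+f_wx^w$ modulo $x^{w+1}$. $G=\{\langle f\rangle: f\in M\}$ is an abelian group of order $q^w$ under $\langle f\rangle\langle g\rangle=\langle fg\rangle$, with identity $\langle 1\rangle$. $\mathbb{C}[G]$ is the complex group ring, with multiplicative identity $1=\langle 1\rangle$; $E=\frac{1}{q^w}\sum_{\gamma\in G}\gamma\in\mathbb{C}[G]$ and $J=1-E$. The $u_i$ ($i\in T$) and $z$ are commuting indeterminates. For a formal power series over $\mathbb{C}[G]$ in these indeterminates, $[\langle f\rangle z^m\prod_{i\in T}u_i^{r_i}]$ denotes the complex coefficient of the group element $\langle f\rangle$ in the coefficient (in $\mathbb{C}[G]$) of $z^m\prod_{i\in T}u_i^{r_i}$. An empty sum is $0$, an empty product is $1$, and $\mathbf{1}[P]$ is $1$ if $P$ is true and $0$ otherwise. *)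

(* Defs.v *)
From HB Require Import structures.
From mathcomp Require Import all_boot all_order all_algebra all_fingroup.
From mathcomp Require Import finmap monalg.
From mathcomp Require Import reals complex zify.

Set Implicit Arguments.
Unset Strict Implicit.
Unset Printing Implicit Defensive.

Import GRing.Theory.
Local Open Scope ring_scope.

Section MonicPolynomials.
Variable F : finFieldType.

Definition monics (d : nat) : {fset {poly F}} :=
  [fset polyn h | h in {: {poly_(d.+1) F}}
                & (polyn h \is monic) && (size (polyn h) == d.+1)]%fset.

Lemma in_monics d (p : {poly F}) :
  (p \in monics d) = (p \is monic) && (size p == d.+1).
Proof.
apply/imfsetP/idP => /= [[h /andP[_ hP] ->] //|pP].
have ps : (size p <= d.+1)%N by case/andP: pP => _ /eqP->.
by exists (npolyp d.+1 p); rewrite ?inE npolypK.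
Qed.

Definition irreds (i : nat) : {fset {poly F}} :=
  [fset p in monics i | irreducibleb p]%fset.

Lemma in_irreds i (p : {poly F}) :
  p \in irreds i <->
    [/\ p \is monic, size p = i.+1 & irreducible_poly p].
Proof.
rewrite !inE /= in_monics; split.
  by case/andP=> /andP[pm /eqP ps] /irreducibleP pirr.
by case=> -> -> /irreducibleP ->; rewrite eqxx.
Qed.

End MonicPolynomials.

Section ReversedClasses.
Variables (F : finFieldType) (w : nat).

Definition truncPoly : Type := {poly %/ ('X^(w.+1) : {poly F})}.
HB.instance Definition _ := GRing.ComUnitRing.on truncPoly.
HB.instance Definition _ := Finite.on truncPoly.

(* x^(deg f) f(1/x) *)
Definition revPoly (f : {poly F}) : {poly F} := Poly (rev f).

Lemma revPolyM (f g : {poly F}) : revPoly (f * g) = revPoly f * revPoly g.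
Proof.
pose h n (p : {poly F}) := \sum_(i < n.+1) p`_i *: 'X^(n - i).
have revE p : revPoly p = h (size p).-1 p.
  rewrite /h /revPoly; apply/polyP => k; rewrite coef_Poly coef_sum.
  case: (ltnP k (size p)) => kp; last first.
    rewrite nth_default ?size_rev // big1 // => i _.
    rewrite coefZ coefXn; case: eqP; last by rewrite mulr0.
    case: (posnP (size p)) => [p0 _|p0 ki].
      by rewrite nth_default ?mul0r // (leq_trans (eq_leq p0)).
    by move: kp; rewrite ki -{1}(prednK p0) ltnNge leq_subr.
  have p0 : (0 < size p)%N by apply: leq_ltn_trans kp.
  rewrite nth_rev // (bigD1 (inord (size p - k.+1))) //= big1 ?addr0.
    have lt1 : (size p - k.+1 < (size p).-1.+1)%N by rewrite prednK // ltn_subrL.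
    rewrite inordK // coefZ coefXn.
    have -> : ((size p).-1 - (size p - k.+1) = k)%N by lia.
    by rewrite eqxx mulr1.
  move=> i ni; rewrite coefZ coefXn; case: eqP; rewrite ?mulr0 // => ki.
  case/eqP: ni; apply: val_inj; rewrite /= inordK ?prednK ?ltn_subrL //.
  by have := ltn_ord i; lia.
have hE n (p : {poly F}) : (size p <= n.+1)%N -> p = \sum_(i < n.+1) p`_i *: 'X^i.
  move=> pn; apply/polyP=> k; rewrite coef_sum.
  under eq_bigr do rewrite coefZ coefXn.
  case: (ltnP k n.+1) => kn.
    rewrite (bigD1 (Ordinal kn)) //= eqxx mulr1 big1 ?addr0 // => i ni.
    by case: eqP => [ki|]; rewrite ?mulr0 //; case/eqP: ni; apply: val_inj.
  rewrite nth_default ?(leq_trans pn) // big1 // => i _.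
  case: eqP => [ki|]; last by rewrite mulr0.
  by move: kn; rewrite ki leqNgt ltn_ord.
have hX n i : (i <= n)%N -> h n 'X^i = 'X^(n - i).
  move=> ni; rewrite /h (bigD1 (inord i)) //= inordK ?ltnS //.
  rewrite coefXn eqxx scale1r big1 ?addr0 // => j nj.
  rewrite coefXn; case: eqP => [ji|]; rewrite ?scale0r //.
  by case/eqP: nj; apply: val_inj; rewrite /= inordK.
have hZ n c p : h n (c *: p) = c *: h n p.
  by rewrite scaler_sumr; apply: eq_bigr => i _; rewrite coefZ scalerA.
have hS n I (r : seq I) G : h n (\sum_(i <- r) G i) = \sum_(i <- r) h n (G i).
  rewrite /h exchange_big; apply: eq_bigr => i _ /=.
  by rewrite coef_sum scaler_suml.
have [->|f0] := eqVneq f 0; first by rewrite mul0r /revPoly polyseq0 mul0r.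
have [->|g0] := eqVneq g 0; first by rewrite mulr0 /revPoly polyseq0 mulr0.
rewrite !revE size_mul //.
set m := (size f).-1; set n := (size g).-1.
have sf : size f = m.+1 by rewrite prednK // size_poly_gt0.
have sg : size g = n.+1 by rewrite prednK // size_poly_gt0.
rewrite sf sg addSn addnS /=.
rewrite [in LHS](hE m f) ?sf // [in LHS](hE n g) ?sg // mulr_suml hS.
rewrite [h m f]/h [h n g]/h mulr_suml; apply: eq_bigr => i _.
rewrite mulr_sumr hS mulr_sumr; apply: eq_bigr => j _.
have im : (i <= m)%N by rewrite -ltnS.
have jn : (j <= n)%N by rewrite -ltnS.
rewrite -!scalerAl -!scalerAr -!exprD !hZ hX ?leq_add //.
congr (_ *: (_ *: 'X^_)).
lia.
Qed.

Definition revClass (f : {poly F}) : truncPoly := in_qpoly 'X^(w.+1) (revPoly f).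

Lemma in_truncE (p : {poly F}) :
  polyn (in_qpoly 'X^(w.+1) p) = take_poly w.+1 p.
Proof.
by rewrite Pdiv.IdomainMonic.take_poly_modp /= mk_monic_Xn /=
  -[Pdiv.CommonRing.rmodp]/Pdiv.Ring.rmodp -Pdiv.IdomainMonic.modpE ?monicXn.
Qed.

Definition constCoef (x : truncPoly) : F := (polyn x)`_0.

Lemma constCoefM : {morph constCoef : x y / x * y}.
Proof.
move=> x y; rewrite /constCoef.
have -> : polyn (x * y) = take_poly w.+1 (polyn x * polyn y).
  by rewrite -in_truncE.
by rewrite coef_take_poly /= coefM big_ord1.
Qed.

Lemma constCoef1 : constCoef 1 = 1.
Proof. by rewrite /constCoef /= coefC. Qed.

(* The set of the classes <f>, f monic, is the set of the classes with constant
   coefficient 1: see bclass_bracket and bracket_surj. *)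
Record bracketGroup : predArgType :=
  BracketGroup { bclass :> truncPoly; _ : constCoef bclass == 1 }.
HB.instance Definition _ := [isSub for bclass].
HB.instance Definition _ := [Finite of bracketGroup by <:].

Lemma constCoef_bclass (x : bracketGroup) : constCoef x = 1.
Proof. by case: x => x /= /eqP. Qed.

Lemma size_bclass (x : bracketGroup) : (size (polyn (bclass x)) <= w.+1)%N.
Proof.
have := size_mk_monic (bclass x); move: (polyn _) => p.
by rewrite mk_monic_Xn size_polyXn ltnS.
Qed.

Lemma bclass_unit (x : bracketGroup) : (x : truncPoly) \is a GRing.unit.
Proof.
have xE : (polyn (bclass x))`_0 = 1 := constCoef_bclass x.
change (coprimep (mk_monic ('X^(w.+1) : {poly F})) (polyn (bclass x))).
move: (polyn _) xE => p p0E; rewrite mk_monic_Xn /=; apply: coprimep_expl.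
rewrite coprimep_sym -['X]subr0 -polyC0 coprimep_XsubC /root.
by rewrite horner_coef0 p0E oner_eq0.
Qed.

Lemma bmul_subproof (x y : bracketGroup) :
  constCoef (bclass x * bclass y) == 1.
Proof. by rewrite constCoefM !constCoef_bclass mulr1. Qed.

Lemma binv_subproof (x : bracketGroup) : constCoef (bclass x)^-1 == 1.
Proof.
have := constCoefM (bclass x) (bclass x)^-1.
by rewrite divrr ?bclass_unit // constCoef1 constCoef_bclass mul1r => <-.
Qed.

Lemma bone_subproof : constCoef 1 == 1.
Proof. by rewrite constCoef1. Qed.

Definition bmul x y := BracketGroup (bmul_subproof x y).
Definition binv x := BracketGroup (binv_subproof x).
Definition bone := BracketGroup bone_subproof.

Lemma bmulA : associative bmul.
Proof. by move=> x y z; apply: val_inj; rewrite /= mulrA. Qed.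
Lemma bmul1 : left_id bone bmul.
Proof. by move=> x; apply: val_inj; rewrite /= mul1r. Qed.
Lemma bmulV : left_inverse bone binv bmul.
Proof. by move=> x; apply: val_inj; rewrite /= mulVr ?bclass_unit. Qed.

HB.instance Definition _ :=
  Finite_isGroup.Build bracketGroup bmulA bmul1 bmulV.

Lemma bracketGroupC (x y : bracketGroup) : (x * y = y * x)%g.
Proof. by apply: val_inj; rewrite /= mulrC. Qed.

(* The default value 1 is never taken on the monic polynomials, the only
   arguments of interest. *)
Definition bracket (f : {poly F}) : bracketGroup := insubd bone (revClass f).

Lemma bclass_bracket (f : {poly F}) :
  f \is monic -> bclass (bracket f) = revClass f.
Proof.
move=> fm; rewrite /bracket -[LHS]/(val _) insubdK // unfold_in.
rewrite /constCoef in_truncE coef_take_poly /= coef_Poly.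
by rewrite nth_rev ?subn1 ?size_poly_gt0 ?monic_neq0 // (monicP fm).
Qed.

Lemma bracketM (f g : {poly F}) : f \is monic -> g \is monic ->
  bracket (f * g) = (bracket f * bracket g)%g.
Proof.
move=> fm gm; apply: val_inj; rewrite /= !bclass_bracket ?monicMl //.
by rewrite /revClass revPolyM -in_qpolyM.
Qed.

Lemma bracket_surj (x : bracketGroup) : exists2 f, f \is monic & bracket f = x.
Proof.
pose p := polyn (bclass x); have p0 : p`_0 = 1 := constCoef_bclass x.
have sp : (size p <= w.+1)%N := size_bclass x.
pose f := \poly_(i < w.+1) p`_(w - i).
have sf : size f = w.+1.
  by apply: size_poly_eq; rewrite /= subnn p0 oner_neq0.
have fm : f \is monic.
  by apply/monicP; rewrite lead_coefE sf coef_poly ltnSn /= subnn.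
exists f => //; apply: val_inj; rewrite [LHS]bclass_bracket //.
apply: val_inj; rewrite [LHS]in_truncE; apply/polyP => k /=.
rewrite coef_take_poly coef_Poly; case: ltnP => kw; last first.
  by rewrite nth_default // (leq_trans sp).
rewrite nth_rev ?sf // coef_poly subSS ltnS leq_subr.
by congr (p`_ _); lia.
Qed.

Lemma card_bracketGroup : #|{: bracketGroup}| = (#|F| ^ w)%N.
Proof.
rewrite -(card_npoly F w); symmetry.
have val_b (p : {poly F}) : p`_0 = 1 ->
    polyn (bclass (insubd bone (in_qpoly 'X^(w.+1) p))) = take_poly w.+1 p.
  move=> p0; rewrite -[bclass _]/(val _) insubdK ?in_truncE // unfold_in.
  by rewrite /constCoef in_truncE coef_take_poly p0.
pose f (h : {poly_w F}) : bracketGroup :=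
  insubd bone (in_qpoly 'X^(w.+1) (1 + polyn h * 'X)).
have c0 (h : {poly F}) : (1 + h * 'X)`_0 = 1.
  by rewrite coefD coefMX coefC addr0.
have fE h i : (polyn (bclass (f h)))`_i =
    if (i < w.+1)%N then (if i == 0%N then 1 else (polyn h)`_i.-1) else 0.
  rewrite val_b // coef_take_poly coefD coefMX coefC.
  by case: ifP => //; case: i => [|i] /=; rewrite ?addr0 ?add0r.
apply: (bij_eq_card (f := f)).
exists (fun x => npolyp w (drop_poly 1 (polyn (bclass x)))) => [h|x].
  apply/npolyP => i; rewrite coef_npolyp coef_drop_poly addn1 fE ltnS /=.
  by case: ltnP => // wi; rewrite big_coef_npoly.
apply: val_inj; apply: val_inj; apply/polyP => i; rewrite [LHS]fE.
have sx := size_bclass x.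
case: ltnP => iw; last by rewrite nth_default // (leq_trans sx).
case: i iw => [|i] iw /=; first by rewrite -[RHS]/(constCoef _) constCoef_bclass.
by rewrite coef_npolyp coef_drop_poly addn1 -ltnS iw.
Qed.

End ReversedClasses.

Section GroupRing.
Variables (K : comNzRingType) (gT : finGroupType).

Definition groupRing : Type := {ffun gT -> K}.
HB.instance Definition _ := GRing.Zmodule.on groupRing.

Definition gcoef (g : gT) (a : groupRing) : K := (a : {ffun gT -> K}) g.

Definition gelt (g : gT) : groupRing := [ffun h => (h == g)%:R].

Definition gmul (a b : groupRing) : groupRing :=
  [ffun g => \sum_(h : gT) gcoef h a * gcoef (h^-1 * g)%g b].

Lemma gmulA : associative gmul.
Proof.
move=> a b c; apply/ffunP => g; rewrite !ffunE.
under eq_bigr do rewrite /gcoef ffunE mulr_sumr.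
under [RHS]eq_bigr do rewrite /gcoef ffunE mulr_suml.
rewrite [RHS]exchange_big /=; apply: eq_bigr => h _.
rewrite [RHS](reindex (fun k => h * k)%g) /=; last first.
  by exists (fun k => h^-1 * k)%g => k _; rewrite ?mulKg ?mulKVg.
by apply: eq_bigr => k _; rewrite mulKg invMg !mulgA mulrA.
Qed.

Lemma gmul1 : left_id (gelt 1) gmul.
Proof.
move=> a; apply/ffunP => g; rewrite !ffunE (bigD1 1%g) //= /gcoef ffunE eqxx.
rewrite invg1 mul1g mul1r big1 ?addr0 // => h /negPf nh.
by rewrite ffunE nh mul0r.
Qed.

Lemma gmulr1 : right_id (gelt 1) gmul.
Proof.
move=> a; apply/ffunP => g; rewrite !ffunE (bigD1 g) //= /gcoef ffunE.
rewrite mulVg eqxx mulr1 big1 ?addr0 // => h nh.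
by rewrite ffunE -eq_mulVg1 (negPf nh) mulr0.
Qed.

Lemma gmulDl : left_distributive gmul +%R.
Proof.
move=> a b c; apply/ffunP => g; rewrite !ffunE -big_split /=.
by apply: eq_bigr => h _; rewrite /gcoef ffunE mulrDl.
Qed.

Lemma gmulDr : right_distributive gmul +%R.
Proof.
move=> a b c; apply/ffunP => g; rewrite !ffunE -big_split /=.
by apply: eq_bigr => h _; rewrite /gcoef ffunE mulrDr.
Qed.

Lemma gone_neq0 : gelt 1 != 0.
Proof.
by apply/eqP => /ffunP/(_ 1%g)/eqP; rewrite !ffunE eqxx oner_eq0.
Qed.

HB.instance Definition _ := GRing.Zmodule_isNzRing.Build groupRing
  gmulA gmul1 gmulr1 gmulDl gmulDr gone_neq0.

Definition gscale (c : K) (a : groupRing) : groupRing :=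
  [ffun g => c * gcoef g a].

Lemma gscaleA c d a : gscale c (gscale d a) = gscale (c * d) a.
Proof. by apply/ffunP => g; rewrite /gscale /gcoef !ffunE mulrA. Qed.
Lemma gscale1 : left_id 1 gscale.
Proof. by move=> a; apply/ffunP => g; rewrite /gscale /gcoef !ffunE mul1r. Qed.
Lemma gscaleDr : right_distributive gscale +%R.
Proof.
by move=> c a b; apply/ffunP => g; rewrite /gscale /gcoef !ffunE mulrDr.
Qed.
Lemma gscaleDl a : {morph gscale^~ a : c d / c + d}.
Proof.
by move=> c d; apply/ffunP => g; rewrite /gscale /gcoef !ffunE mulrDl.
Qed.

HB.instance Definition _ := GRing.Zmodule_isLmodule.Build K groupRing
  gscaleA gscale1 gscaleDr gscaleDl.
End GroupRing.

Lemma gmulC_bracket (K : comNzRingType) (F : finFieldType) (w : nat) :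
  @commutative (groupRing K (bracketGroup F w)) _ *%R.
Proof.
move=> a b; apply/ffunP => g; rewrite !ffunE.
rewrite (reindex (fun h => h^-1 * g)%g) /=; last first.
  exists (fun h => g * h^-1)%g => h _; first by rewrite invMg invgK mulKVg.
  by rewrite invMg invgK -mulgA mulVg mulg1.
apply: eq_bigr => h _; rewrite mulrC invMg invgK.
by rewrite [(g^-1 * h)%g]bracketGroupC -mulgA mulVg mulg1.
Qed.

HB.instance Definition _ (K : comNzRingType) (F : finFieldType) (w : nat) :=
  GRing.PzRing_hasCommutativeMul.Build (groupRing K (bracketGroup F w))
    (@gmulC_bracket K F w).

Definition idempE (C : fieldType) (F : finFieldType) (w : nat) :
    groupRing C (bracketGroup F w) :=
  ((#|F| ^ w)%N%:R)^-1 *: \sum_(g : bracketGroup F w) gelt C g.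

Definition idempJ (C : fieldType) (F : finFieldType) (w : nat) :
    groupRing C (bracketGroup F w) := 1 - idempE C F w.

Section Indeterminates.
Variables (A : comNzRingType) (T : {fset nat}).

(* The polynomial ring A[z, u_i (i in T)]; its elements are the formal power
   series with finitely many nonzero coefficients. The indeterminate z is
   indexed by None, and u_i by Some i. *)
Definition zuPoly : Type := {malg A[{cmonom (option T)}]}.
HB.instance Definition _ := GRing.ComNzRing.on zuPoly.

Definition zvar : zuPoly := << ucm None >>.
Definition uvar (i : T) : zuPoly := << ucm (Some i) >>.
Definition zuconst (a : A) : zuPoly := << a *g mone >>.

Definition zumonom (m : nat) (r : T -> nat) : {cmonom (option T)} :=
  mmul (expcmn (ucm None) m)
       (\big[mmul/mone]_(i : T) expcmn (ucm (Some i)) (r i)).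

Definition zucoef (k : {cmonom (option T)}) (p : zuPoly) : A := mcoeff k p.

End Indeterminates.

Section Counting.
Variables (F : finFieldType) (w : nat) (T : {fset nat}).

Definition countN (m : nat) (r : T -> nat) (g0 : bracketGroup F w) : nat :=
  #|` [fset g in monics F m | (bracket w g == g0) &&
        [forall i : T, #|` [fset p in irreds F (val i) | p %| g]| == r i]]%fset |.

End Counting.

(* Main.v *)
(* Write D_S for the product of a finite set S of monic irreducible polynomials
   with degrees in T, and k_i(S) for the number of its members of degree i. For
   each g, expanding prod_(p | g) (1 + (u_(deg p) - 1)) and taking the
   coefficient of prod_i u_i^(r_i) turns the condition on g into the sum, over
   the S with D_S | g, of prod_i (-1)^(k_i(S) - r_i) 'C(k_i(S), r_i). Summing
   over g of degree m first, the multiples of D_S contribute <D_S> B_(m - deg D_S),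
   where B_d is the sum of the classes of the monic polynomials of degree d. For
   d >= w every class is hit equally often, so B_d = q^d E; for d < w one has
   B_d = q^d E + J B_d. The terms in E depend on S through the k_i(S) only and
   add up to the sum over j with j_i = k_i(S) - r_i; the terms in J form the
   coefficient in the statement. *)
From HB Require Import structures.
Require Import Defs.
From mathcomp Require Import all_boot all_order all_algebra all_fingroup.
From mathcomp Require Import finmap monalg reals complex.
From mathcomp Require Import zify ring.

Set Implicit Arguments.
Unset Strict Implicit.
Unset Printing Implicit Defensive.

Import GRing.Theory.
Local Open Scope ring_scope.

(** * Monomials in [z] and the [u_i], and their coefficients *)

Lemma mulr_monomials (R : comNzRingType) (a b z p : R) m n :
  (a * z ^+ m) * (b * z ^+ n * p) = a * b * z ^+ (m + n) * p.
Proof. by rewrite exprD mulrA [a * _ * _]mulrACA. Qed.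

Lemma zumonomE (T : {fset nat}) m (r : T -> nat) (o : option T) :
  zumonom m r o = if o is Some i then r i else m.
Proof.
have expE (x : {cmonom (option T)}) n j : expcmn x n j = (n * x j)%N.
  rewrite /expcmn; elim: n => [|[|n] IHn] /=; rewrite ?mul1n ?cm1 //.
  by rewrite cmM [X in (_ + X)%N]IHn mulSn.
have bigE (F : T -> {cmonom (option T)}) j :
    (\big[mmul/mone]_(i : T) F i) j = (\sum_(i : T) F i j)%N.
  elim/big_rec2: _ => [|i n x _ <-]; first by rewrite cm1.
  by rewrite cmM.
rewrite /zumonom cmM bigE expE cmU.
under eq_bigr do rewrite expE cmU.
case: o => [i|] /=; last by rewrite muln1 big1 ?addn0 // => j _; rewrite muln0.
rewrite muln0 add0n (bigD1 i) //= eqxx muln1 big1 ?addn0 // => j /negPf ji.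
by rewrite -[Some j == _]/(j == i) ji muln0.
Qed.

(** Evaluating a monomial at [None] and at [Some i] recovers all its exponents, so equality of
    monomials becomes a decidable condition on [m] and [k]. *)
Lemma eq_zumonom (T : {fset nat}) m n (k r : T -> nat) :
  (zumonom m k == zumonom n r) = (m == n) && [forall i, k i == r i].
Proof.
apply/eqP/andP => [e|[/eqP-> /'forall_eqP kr]].
  split; first by have := zumonomE m k None; rewrite e zumonomE => ->.
  apply/'forall_eqP => i.
  by have := zumonomE m k (Some i); rewrite e zumonomE.
by congr (mmul _ _); apply: eq_bigr => i _; rewrite kr.
Qed.

Section Coefficients.
Variables (A : comNzRingType) (T : {fset nat}).
Local Notation P := (zuPoly A T).

Lemma zumonoM (a b : A) (k l : {cmonom (option T)}) :
  (<< a *g k >> : P) * << b *g l >> = << a * b *g mmul k l >>.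
Proof. exact: fgmulUU. Qed.

Lemma zumonoX (x : {cmonom (option T)}) n :
  (<< x >> : P) ^+ n = << expcmn x n >>.
Proof.
have XS j : mmul x (expcmn x j) = expcmn x j.+1.
  by case: j => [|//]; exact: mulm1.
elim: n => [|n IHn]; first by rewrite expr0.
rewrite exprS IHn zumonoM mulr1 XS; reflexivity.
Qed.

Lemma zuconstM : {morph @zuconst A T : a b / a * b}.
Proof. by move=> a b; rewrite /zuconst zumonoM mulm1. Qed.

Lemma zuconst1 : zuconst T 1 = 1 :> P.
Proof. by []. Qed.

Lemma zutermM (a b : A) m n (p : P) :
  (zuconst T a * zvar A T ^+ m) * (zuconst T b * zvar A T ^+ n * p) =
  zuconst T (a * b) * zvar A T ^+ (m + n) * p.
Proof.
by rewrite zuconstM; apply: mulr_monomials.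
Qed.

Lemma zuterm (a : A) m (k : T -> nat) :
  zuconst T a * zvar A T ^+ m * \prod_(i : T) uvar A i ^+ k i =
  << a *g zumonom m k >>.
Proof.
have prodE : \prod_(i : T) uvar A i ^+ k i =
    << \big[mmul/mone]_(i : T) expcmn (ucm (Some i)) (k i) >>.
  elim/big_rec2: _ => [|i x y _ ->]; first by [].
  by rewrite /uvar zumonoX zumonoM mulr1.
rewrite prodE /zvar zumonoX /zuconst zumonoM zumonoM mul1m mulr1 mulr1.
reflexivity.
Qed.

Lemma zucoef_sum (J : Type) (s : seq J) (Q : pred J) (G : J -> P) x :
  zucoef x (\sum_(j <- s | Q j) G j) = \sum_(j <- s | Q j) zucoef x (G j).
Proof. exact: (raddf_sum (mcoeff x)). Qed.

Lemma zucoefMz x (p : P) n : zucoef x (p *~ n) = zucoef x p *~ n.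
Proof. exact: (raddfMz (mcoeff x)). Qed.

Lemma zucoef_term (a : A) m n (k r : T -> nat) :
  zucoef (zumonom m r)
    (zuconst T a * zvar A T ^+ n * \prod_(i : T) uvar A i ^+ k i) =
  a *+ ((n == m) && [forall i, k i == r i]).
Proof. by rewrite zuterm /zucoef mcoeffU eq_zumonom. Qed.

End Coefficients.

(** * Powers of [u_i - 1] and inclusion-exclusion over subsets *)

(* The coefficient of x ^+ r in (x - 1) ^+ k; it vanishes for k < r, where the
   exponent k - r is truncated. *)
Definition sbin (k r : nat) : int := (-1) ^+ (k - r) * 'C(k, r)%:Z.

Lemma exprB1_sbin (A : comNzRingType) (x : A) n N : (n < N)%N ->
  (x - 1) ^+ n = \sum_(j < N) (sbin n j)%:~R * x ^+ j.
Proof.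
move=> nN; rewrite addrC exprDn.
rewrite (big_ord_widen N (fun j => (-1) ^+ (n - j) * x ^+ j *+ 'C(n, j))) //.
rewrite big_mkcond; apply: eq_bigr => j _ /=; rewrite /sbin ltnS.
case: leqP => [_|nj]; last by rewrite bin_small ?mulr0 ?mul0r.
by rewrite rmorphM rmorphXn /= rmorphN1 -mulr_natr mulrAC.
Qed.

Lemma zucoef_sub1 (A : comNzRingType) (T : {fset nat}) (a : A) m n
    (k r : T -> nat) :
  zucoef (zumonom m r)
    (zuconst T a * zvar A T ^+ n * \prod_(i : T) (uvar A i - 1) ^+ k i) =
  a *~ (\prod_(i : T) sbin (k i) (r i)) *+ (n == m).
Proof.
(* A common strict bound for all [k i] and [r i]: the product of sums then distributes over
   functions into one ordinal type, and [r] is one of these functions. *)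
pose N := (\max_(i : T) maxn (k i) (r i)).+1.
have ltN i : (maxn (k i) (r i) < N)%N by rewrite ltnS leq_bigmax.
have kN i : (k i < N)%N by rewrite (leq_ltn_trans _ (ltN i)) ?leq_maxl.
have rN i : (r i < N)%N by rewrite (leq_ltn_trans _ (ltN i)) ?leq_maxr.
under eq_bigr do rewrite (exprB1_sbin _ (kN _)).
rewrite bigA_distr_bigA mulr_sumr zucoef_sum /=.
pose rf : {ffun T -> 'I_N} := [ffun i => Ordinal (rN i)].
have rfE i : rf i = r i :> nat by rewrite ffunE.
have termE (g : {ffun T -> 'I_N}) :
    zucoef (zumonom m r) (zuconst T a * zvar A T ^+ n *
      \prod_(i : T) ((sbin (k i) (g i))%:~R * uvar A i ^+ g i)) =
    a *+ ((n == m) && (g == rf)) *~ (\prod_(i : T) sbin (k i) (g i)).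
  rewrite big_split /= -rmorph_prod mulrCA mulrzl.
  rewrite zucoefMz zucoef_term.
  congr (_ *+ nat_of_bool (_ && _) *~ _).
  apply/forallP/eqP => [gr|-> i]; last by rewrite rfE.
  by apply/ffunP => i; apply: val_inj; rewrite /= (eqP (gr i)) rfE.
under eq_bigr do rewrite termE.
rewrite (bigD1 rf) //= eqxx andbT.
rewrite [X in _ + X]big1 ?addr0 => [|g /negPf->].
  under eq_bigr do rewrite rfE.
  by case: (n == m); rewrite ?mulr1n // !mulr0n mul0rz.
by rewrite andbF mul0rz.
Qed.

(** Both sides are the coefficient of the product of the [u_i ^+ r i] in the product of [u (c x)]
    over [D], where each factor is written as [(u (c x) - 1) + 1] and expanded. *)
Lemma sum_subset_sbin (T : {fset nat}) (X : finType) (c : X -> T) (D : {set X})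
    (r : T -> nat) :
  \sum_(S : {set X} | S \subset D)
     \prod_(i : T) sbin #|[set x in S | c x == i]| (r i) =
  [forall i, #|[set x in D | c x == i]| == r i]%:R.
Proof.
have fibE (S : {set X}) (y : T -> zuPoly int T) : \prod_(x in S) y (c x) =
    \prod_i y i ^+ #|[set x in S | c x == i]|.
  rewrite (partition_big c predT) //=; apply: eq_bigr => i _.
  rewrite -prodr_const; apply: eq_big => x; first by rewrite inE.
  by case/andP => _ /eqP->.
pose u := uvar int (T := T).
have expand : \prod_(x in D) u (c x) =
    \sum_(S : {set X} | S \subset D) \prod_(x in S) (u (c x) - 1).
  (* The product is extended to all of [X] by factors [0 + 1] outside [D]; a subset not contained in
     [D] then picks up a factor 0. *)
  rewrite big_mkcond /= (eq_bigr (fun x =>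
    (if x \in D then u (c x) - 1 else 0) + 1)); last first.
    by move=> x _; case: ifP; rewrite ?subrK ?add0r.
  rewrite bigA_distr [RHS]big_mkcond /=; apply: eq_bigr => S _.
  rewrite -big_mkcond /=; case: ifPn => [/subsetP SD|].
    by apply: eq_bigr => x xS; rewrite SD.
  by case/subsetPn => x xS /negPf xD; rewrite (bigD1 x) //= xD mul0r.
have oneE (p : zuPoly int T) : p = zuconst T 1 * zvar int T ^+ 0 * p.
  by rewrite expr0 mulr1 zuconst1 mul1r.
have /(congr1 (zucoef (zumonom 0 r))) := expand.
rewrite zucoef_sum fibE [X in zucoef _ X]oneE zucoef_term => ->.
apply: eq_bigr => S _.
by rewrite (fibE S (fun i => u i - 1)) [X in zucoef _ X]oneE zucoef_sub1 intz.
Qed.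

(** * Monic polynomials of a given degree *)

Section MonicSums.
Variable F : finFieldType.

Lemma size_monicD d e (a b : {poly F}) : a \in monics F d ->
  (size b <= e)%N -> a * 'X^e + b \in monics F (d + e).
Proof.
rewrite !in_monics => /andP[am /eqP sa] sb.
have sX : size (a * 'X^e) = (d + e).+1.
  by rewrite size_mulXn ?monic_neq0 // sa addnS addnC.
have lt : (size b < size (a * 'X^e)%R)%N by rewrite sX; lia.
rewrite monicE lead_coefDl // size_polyDl // sX eqxx andbT.
by rewrite lead_coef_Mmonic ?monicXn // (monicP am).
Qed.

(** Division with remainder by ['X^e]: the quotient [drop_poly e] is monic of degree [d], and the
    remainder [take_poly e] is arbitrary. *)
Lemma sum_monicsD (V : nmodType) d e (G : {poly F} -> V) :
  \sum_(h <- monics F (d + e)) G h =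
  \sum_(a <- monics F d) \sum_(b : {poly_e F}) G (a * 'X^e + polyn b).
Proof.
rewrite [LHS]big_seq_fsetE [RHS]big_seq_fsetE /= pair_big /=.
pose h (x : monics F d * {poly_e F}) : monics F (d + e) :=
  [` size_monicD (valP x.1) (size_npoly x.2)]%fset.
have dP (p : monics F (d + e)) : drop_poly e (val p) \in monics F d.
  have := valP p; rewrite !in_monics => /andP[pm /eqP sp].
  rewrite size_drop_poly sp; apply/andP; split; last by apply/eqP; lia.
  rewrite monicE lead_coefE size_drop_poly sp coef_drop_poly.
  have -> : (((d + e).+1 - e).-1 + e = (size (val p)).-1)%N by rewrite sp; lia.
  by rewrite -lead_coefE.
rewrite (reindex h) //=.
exists (fun p => ([` dP p]%fset, npolyp e (take_poly e (val p)))) => [[a b] _|p _].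
  congr pair; apply: val_inj => /=.
    by rewrite drop_polyD drop_polyMXn_id drop_poly_eq0 ?addr0 // size_npoly.
  rewrite /h /= take_polyD take_polyMXn_0 add0r take_poly_id ?size_npoly //.
  by rewrite npolypK ?size_npoly.
apply: val_inj; rewrite /= npolypK ?size_take_poly //.
by rewrite addrC poly_take_drop.
Qed.

Lemma monics0 : monics F 0 = [fset 1]%fset.
Proof.
apply/fsetP => p; rewrite in_monics inE; apply/andP/eqP => [[pm /eqP sp]|->].
  have /size1_polyC pE : (size p <= 1)%N by rewrite sp.
  by move/monicP: pm; rewrite pE lead_coefC => ->.
by rewrite monic1 size_poly1.
Qed.

Lemma card_monics d : #|` monics F d| = (#|F| ^ d)%N.
Proof.
(* With a leading part of degree 0, which can only be 1, the [d] lower coefficients are free. *)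
have := sum_monicsD 0 d (fun=> 1%N).
rewrite add0n monics0 big_seq_fset1 [RHS]sum1_card card_npoly => <-.
by rewrite [RHS]sum1_size.
Qed.

Lemma coef_revPoly n (p : {poly F}) k : size p = n.+1 -> (k <= n)%N ->
  (revPoly p)`_k = p`_(n - k).
Proof. by move=> sp kn; rewrite coef_Poly nth_rev ?sp. Qed.

(** Multiplication by [D] is injective, and the quotient of a monic multiple by the monic [D] is
    again monic, of degree [m - e]. *)
Lemma sum_dvd_monics (V : nmodType) (D : {poly F}) e m (G : {poly F} -> V) :
  D \in monics F e ->
  \sum_(g <- monics F m | D %| g) G g =
  if (e <= m)%N then \sum_(h <- monics F (m - e)) G (D * h) else 0.
Proof.
move=> De; have [Dm sD] : D \is monic /\ size D = e.+1.
  by move: De; rewrite in_monics => /andP[-> /eqP->].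
have D0 : D != 0 by rewrite monic_neq0.
case: leqP => em; last first.
  rewrite big_seq_cond big1 // => g; rewrite in_monics.
  case/andP => /andP[gm /eqP sg] /dvdp_leq.
  by rewrite monic_neq0 // sD sg => /(_ isT); lia.
have imE (M : {fset {poly F}}) :
    \sum_(h <- M) G (D * h) = \sum_(g <- [fset D * h | h in M]%fset) G g.
  by rewrite big_imfset //= => x y _ _; apply: mulfI.
rewrite imE big_fset_condE; apply: eq_fbigl => g.
rewrite !inE /= in_monics; apply/andP/imfsetP => /= [[/andP[gm /eqP sg]]|].
  rewrite dvdp_eq => /eqP gE; have hD : g = D * (g %/ D) by rewrite mulrC.
  exists (g %/ D) => //; rewrite in_monics.
  have hm : g %/ D \is monic by rewrite -(monicMl _ Dm) -hD.
  have := size_Mmonic D0 hm; rewrite -hD sg sD addSn /= => sgE.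
  by rewrite hm -subSn // sgE addKn eqxx.
case=> h; rewrite in_monics => /andP[hm /eqP sh] ->; rewrite dvdp_mulr //.
by rewrite monicMl // size_Mmonic ?sD ?sh //; split => //; apply/eqP; lia.
Qed.

End MonicSums.

(** * Sums of classes in the group ring *)

Section ClassSums.
Variables (F : finFieldType) (w : nat).

(** A class depends only on the [w + 1] leading coefficients, and here these are the coefficients of
    [a]. *)
Lemma bracket_low e (a b : {poly F}) : a \in monics F w ->
  (size b <= e)%N -> bracket w (a * 'X^e + b) = bracket w a.
Proof.
move=> aw sb; have abw := size_monicD aw sb.
move: (aw) (abw); rewrite !in_monics => /andP[am /eqP sa] /andP[abm /eqP sab].
apply: val_inj; rewrite /= !bclass_bracket //.
apply: val_inj; rewrite /= [LHS]in_truncE [RHS]in_truncE.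
apply/polyP => k; rewrite !coef_take_poly; case: ltnP => // kw.
rewrite (coef_revPoly sab) ?(coef_revPoly sa); [|lia..].
(* As [k <= w], the index [w + e - k] is at least [e], beyond the coefficients of [b]. *)
rewrite coefD coefMXn [b`__]nth_default ?addr0; last first.
  by apply: leq_trans sb _; lia.
by rewrite ifF; [congr (a`_ _)|]; lia.
Qed.

Lemma bracket_inj : {in monics F w &, injective (bracket w)}.
Proof.
move=> a b; rewrite !in_monics => /andP[am /eqP sa] /andP[bm /eqP sb] ab.
have := congr1 (fun x => polyn (bclass x)) ab.
rewrite !bclass_bracket // [LHS]in_truncE [RHS]in_truncE => abE.
apply/polyP => k; case: (leqP k w) => kw; last by rewrite !nth_default ?sa ?sb.
have := congr1 (fun p : {poly F} => p`_(w - k)) abE.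
rewrite !coef_take_poly ltnS leq_subr.
by rewrite (coef_revPoly sa) ?(coef_revPoly sb) ?leq_subr // subKn.
Qed.

(** By [bracket_inj] the classes of the monic polynomials of degree [w] are distinct; there are as
    many of them as group elements, so each element occurs once. *)
Lemma sum_bracket_monics (V : nmodType) (G : bracketGroup F w -> V) :
  \sum_(a <- monics F w) G (bracket w a) = \sum_g G g.
Proof.
rewrite big_seq_fsetE /= [RHS](reindex (fun a : monics F w => bracket w (val a))) //.
apply: onW_bij; apply: inj_card_bij => [a b /bracket_inj|].
  by move=> /(_ (valP a) (valP b)) /val_inj.
by rewrite card_bracketGroup -cardfE card_monics.
Qed.

Variable K : fieldType.
Local Notation A := (groupRing K (bracketGroup F w)).

(** The [B_d] of the overview. *)
Definition classSum d : A := \sum_(h <- monics F d) gelt K (bracket w h).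

Lemma gelt_mul (x y : bracketGroup F w) : gelt K (x * y)%g = gelt K x * gelt K y.
Proof.
apply/ffunP => g; rewrite [RHS]ffunE ffunE (bigD1 x) //= /gcoef !ffunE eqxx mul1r.
rewrite big1 => [|h /negPf hx]; last by rewrite ffunE hx mul0r.
by rewrite addr0 -(inj_eq (mulgI x) (x^-1 * g)%g) mulKVg.
Qed.

Hypothesis qK : #|F|%:R != 0 :> K.

(** Translation by [x] permutes the summands of [idempE]. *)
Lemma idempE_gelt x : idempE K F w * gelt K x = idempE K F w.
Proof.
have scaleMl c (a b : A) : (c *: a) * b = c *: (a * b).
  apply/ffunP => h; rewrite !ffunE /gcoef ffunE mulr_sumr.
  by apply: eq_bigr => j _; rewrite !ffunE mulrA.
rewrite /idempE scaleMl mulr_suml; congr (_ *: _).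
rewrite [RHS](reindex_inj (mulIg x)) /=.
by apply: eq_bigr => y _; rewrite gelt_mul.
Qed.

Lemma gcoef_idempE x : gcoef x (idempE K F w) = (#|F|%:R ^+ w)^-1.
Proof.
rewrite /gcoef ffunE /gcoef sum_ffunE (bigD1 x) //= ffunE eqxx big1 => [|y yx].
  by rewrite addr0 mulr1 natrX.
by rewrite ffunE eq_sym (negPf yx).
Qed.

Lemma idempE_classSum d : idempE K F w * classSum d = idempE K F w *+ #|F| ^ d.
Proof.
rewrite /classSum mulr_sumr; under eq_bigr do rewrite idempE_gelt.
by rewrite big_const_seq count_predT iter_addr_0 card_monics.
Qed.

(** The leading part of degree [w] determines the class and runs through the group once; the [d - w]
    lower coefficients are free, so each class occurs [#|F| ^ (d - w)] times. *)
Lemma classSum_large d : (w <= d)%N -> classSum d = idempE K F w *+ #|F| ^ d.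
Proof.
move=> /subnKC <-; rewrite /classSum sum_monicsD.
rewrite big_seq; under eq_bigr => a aw.
  under eq_bigr => b _ do rewrite (bracket_low aw (size_npoly b)).
  rewrite sumr_const card_npoly; over.
rewrite -big_seq sumrMnl (sum_bracket_monics (@gelt K _)) expnD mulrnA.
congr (_ *+ _).
by rewrite /idempE -scaler_nat scalerA mulfV ?scale1r // natrX expf_neq0.
Qed.

Lemma classSumE d :
  classSum d = idempE K F w *+ #|F| ^ d +
    (if (d < w)%N then idempJ K F w * classSum d else 0).
Proof.
case: ltnP => [_|/classSum_large]; last by rewrite addr0.
by rewrite /idempJ mulrBl mul1r idempE_classSum addrC subrK.
Qed.

End ClassSums.

(** * Counting subsets by the sizes of their fibres *)

(** Multiplied by [r! j! (n - r - j)!], both sides become [n!]. *)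
Lemma mul_bin_trans n r j : (r + j <= n)%N ->
  ('C(n, r + j) * 'C(r + j, r) = 'C(n, r) * 'C(n - r, j))%N.
Proof.
move=> rjn; have rn : (r <= n)%N by lia.
have jn : (j <= n - r)%N by lia.
have pos : (0 < r`! * (j`! * (n - (r + j))`!))%N by rewrite !muln_gt0 !fact_gt0.
apply/eqP; rewrite -(eqn_pmul2r pos); apply/eqP.
have e1 := bin_fact rjn; have e2 := bin_fact rn; have e3 := bin_fact jn.
have := bin_fact (leq_addr j r); rewrite addKn => e4.
rewrite -subnDA in e3.
transitivity n`!; first by rewrite -e1 -e4; ring.
by rewrite -e2 -e3; ring.
Qed.

Section FiberwiseDraws.
Variables (X I : finType) (c : X -> I).
Local Notation fib S i := [set x in S | c x == i].

(** A subset is the union of its fibres, and these can be chosen independently of each other. *)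
Lemma card_fiberwise_draws (k : I -> nat) :
  #|[set S : {set X} | [forall i, #|fib S i| == k i]]| =
  (\prod_(i : I) 'C(#|[set x | c x == i]|, k i))%N.
Proof.
pose D i := [set A : {set X} | A \subset [set x | c x == i] & #|A| == k i].
have DE i : 'C(#|[set x | c x == i]|, k i) = #|D i| by rewrite cards_draws.
under eq_bigr do rewrite DE.
have -> : (\prod_(i : I) #|D i|)%N =
    #|(family (fun i => mem (D i)) : simpl_pred {ffun I -> {set X}})|.
  by rewrite card_family foldrE big_image.
pose h (S : {set X}) : {ffun I -> {set X}} := [ffun i => fib S i].
pose g (f : {ffun I -> {set X}}) := \bigcup_i f i.
have gh S : g (h S) = S.
  apply/setP => x; apply/bigcupP/idP => [[i _]|xS].
    by rewrite ffunE inE => /andP[].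
  by exists (c x) => //; rewrite ffunE inE xS eqxx.
rewrite -!sum1_card [RHS](reindex_onto h g) => [|f /familyP fD].
  apply: eq_bigl => S; rewrite gh eqxx andbT inE.
  apply/forallP/familyP => [Sk i|Sk i].
    by rewrite ffunE inE Sk andbT; apply/subsetP => x; rewrite !inE => /andP[].
  by have := Sk i; rewrite ffunE inE => /andP[].
apply/ffunP => i; rewrite ffunE; apply/setP => x; rewrite inE.
have cE j y : y \in f j -> c y = j.
  have := fD j; rewrite inE => /andP[/subsetP fj _] /fj.
  by rewrite inE => /eqP.
apply/andP/idP => [[/bigcupP[j _ xj] /eqP <-]|xi].
  by rewrite (cE _ _ xj).
by rewrite (cE _ _ xi) eqxx; split => //; apply/bigcupP; exists i.
Qed.

(** Subsets are grouped by their fibre sizes [r i + j i], and [mul_bin_trans] rearranges the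
    binomials. If some [r i] exceeds [n i], the type of [j i] is ['I_0], so the right side is an
    empty sum. *)
Lemma sum_sbin_draws (R : comNzRingType) (d n r : I -> nat) (G : nat -> R) :
  (forall i, #|[set x | c x == i]| = n i) ->
  \sum_(S : {set X})
     G (\sum_i d i * #|fib S i|)%N * (\prod_i sbin #|fib S i| (r i))%:~R =
  \sum_(j : {dffun forall i : I, 'I_((n i).+1 - r i)})
     G (\sum_i d i * (r i + j i))%N *
     \prod_i ('C(n i, r i)%:R * 'C(n i - r i, j i)%:R * (-1) ^+ j i).
Proof.
move=> nE; pose J := {dffun forall i : I, 'I_((n i).+1 - r i)}.
pose t (S : {set X}) : R :=
  G (\sum_i d i * #|fib S i|)%N * (\prod_i sbin #|fib S i| (r i))%:~R.
(* A subset with a fibre smaller than [r i] has weight 0; any other subset matches exactly one [j],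
   the excess of its fibre sizes over [r]. *)
have tE S : t S = \sum_(j : J | [forall i, #|fib S i| == (r i + j i)%N]) t S.
  case: (boolP [forall i, r i <= #|fib S i|]%N) => [/forallP rS|]; last first.
    case/forallPn => i; rewrite -ltnNge => ki; have -> : t S = 0.
      by rewrite /t [X in X%:~R](bigD1 i) //= /sbin bin_small // mulr0 mul0r mulr0.
    by rewrite big1.
  have le_n i : (#|fib S i| <= n i)%N.
    by rewrite -nE; apply/subset_leq_card/subsetP => x; rewrite !inE => /andP[].
  have ltS i : (#|fib S i| - r i < (n i).+1 - r i)%N.
    by have := rS i; have := le_n i; lia.
  pose j0 : J := [ffun i => Ordinal (ltS i)].
  rewrite (big_pred1 j0) // => j; apply/forallP/eqP => [jS|-> i].
    by apply/ffunP => i; apply: val_inj; rewrite ffunE /= (eqP (jS i)) addKn.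
  by rewrite ffunE /= subnKC.
under eq_bigr do rewrite -/(t _) tE.
rewrite (exchange_big_dep predT) //=; apply: eq_bigr => j _.
have rj i : (r i + j i <= n i)%N by have := ltn_ord (j i); lia.
transitivity (\sum_(S : {set X} | [forall i, #|fib S i| == (r i + j i)%N])
    G (\sum_i d i * (r i + j i))%N * (\prod_i sbin (r i + j i) (r i))%:~R).
  apply: eq_bigr => S /'forall_eqP kS; rewrite /t.
  by congr (G _ * _%:~R); apply: eq_bigr => i _; rewrite kS.
rewrite sumr_const -mulrnAr; congr (_ * _).
have := card_fiberwise_draws (fun i => r i + j i)%N; rewrite cardsE => ->.
rewrite -mulr_natr rmorph_prod natr_prod -big_split; apply: eq_bigr => i _ /=.
rewrite /sbin addKn rmorphM rmorphXn /= rmorphN1 -[_%:~R]/(_%:R).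
by rewrite mulrAC -mulrA [LHS]mulrC -!natrM nE mul_bin_trans.
Qed.
End FiberwiseDraws.

(** * Sets of monic irreducibles with degrees in [T] *)

Section IrreducibleFactors.
Variables (F : finFieldType) (T : {fset nat}).

(** A tagged union: [tag] reads off the degree, so that the fibre counts above apply with [c] equal
    to [tag]. *)
Definition irrIdx : finType := {i : T & irreds F (val i)}.
Definition irrPoly (x : irrIdx) : {poly F} := val (tagged x).

Lemma irrPolyP x : [/\ irrPoly x \is monic, size (irrPoly x) = (val (tag x)).+1 &
  irreducible_poly (irrPoly x)].
Proof. exact/in_irreds/valP. Qed.

Lemma irrPoly_inj : injective irrPoly.
Proof.
move=> x y xy; have [_ sx _] := irrPolyP x; have [_ sy _] := irrPolyP y.
have : tag x = tag y by apply: val_inj; apply: succn_inj; rewrite -sx -sy xy.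
case: x y {sx sy} xy => [i p] [j q] /= pq ij.
by move: ij q pq => <- q /val_inj /= <-.
Qed.

Lemma card_irrIdx (Q : pred {poly F}) i :
  #|[set x : irrIdx | Q (irrPoly x) & tag x == i]| =
  #|` [fset p in irreds F (val i) | Q p]%fset|.
Proof.
have -> : [set x : irrIdx | Q (irrPoly x) & tag x == i] =
    [set Tagged (fun i : T => irreds F (val i)) p |
      p in [set p : irreds F (val i) | Q (val p)]].
  apply/setP => x; rewrite inE; apply/andP/imsetP => [[Qx /eqP xi]|[p]].
    case: x xi Qx => j p /= ji; case: i / ji => Qp.
    by exists p; rewrite ?inE.
  by rewrite inE => Qp ->.
rewrite card_imset; last by move=> p q /eqP; rewrite eq_Tagged => /eqP.
rewrite -sum1_card -sum1_size -big_fset_condE big_seq_fsetE /=.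
by apply: eq_bigl => p; rewrite inE.
Qed.

(** [irrProd S] is the [D_S] of the overview, and [irrDeg S] is its degree. *)
Definition irrDeg (S : {set irrIdx}) : nat := \sum_(x in S) val (tag x).
Definition irrProd (S : {set irrIdx}) : {poly F} := \prod_(x in S) irrPoly x.

Lemma irrDegE S :
  irrDeg S = (\sum_(i : T) val i * #|[set x in S | tag x == i]|)%N.
Proof.
rewrite /irrDeg (partition_big (fun x : irrIdx => tag x) predT) //=.
apply: eq_bigr => i _; rewrite mulnC -sum_nat_const.
by apply: eq_big => [x|x /andP[_ /eqP->//]]; rewrite inE.
Qed.

Lemma irrProd_monics S : irrProd S \in monics F (irrDeg S).
Proof.
rewrite in_monics /irrProd /irrDeg.
elim/big_rec2: _ => [|x p d _ /andP[pm /eqP sp]]; first by rewrite monic1 size_poly1.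
have [xm sx _] := irrPolyP x.
by rewrite monicMl // pm size_Mmonic ?monic_neq0 // sp sx addSn addnS eqxx.
Qed.

(** Distinct monic irreducibles are coprime, so divisibility by each factor gives divisibility by
    the product, one factor at a time. *)
Lemma irrProd_dvd S (g : {poly F}) :
  (irrProd S %| g) = (S \subset [set x | irrPoly x %| g]).
Proof.
apply/idP/subsetP => [Sg x xS|].
  by rewrite inE (dvdp_trans _ Sg) // /irrProd (bigD1 x) //= dvdp_mulIl.
move=> Sg; rewrite /irrProd -big_enum /=.
have : {in enum S, forall x, irrPoly x %| g}.
  by move=> x; rewrite mem_enum => /Sg; rewrite inE.
elim: (enum S) (enum_uniq S) => [|x s IHs] /=; first by rewrite big_nil dvd1p.
case/andP=> xs us sg; rewrite big_cons Gauss_dvdp ?sg ?mem_head //=.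
  by apply: IHs => // y ys; rewrite sg // inE ys orbT.
have [xm _ xirr] := irrPolyP x; rewrite coprimep_sym big_seq.
elim/big_rec: _ => [|y p ys]; first by rewrite coprime1p.
rewrite coprimepMl => ->; rewrite andbT coprimep_sym.
have [ym _ yirr] := irrPolyP y.
rewrite irreducible_poly_coprime //; apply/negP => xy.
(* An irreducible that divides another is associate to it; both being monic, they are equal, which
   contradicts the uniqueness of the entries of the enumeration. *)
have : irrPoly x %= irrPoly y by apply: yirr => //; case: xirr => /gtn_eqF->.
rewrite eqp_monic // => /eqP/irrPoly_inj xyE.
by rewrite xyE ys in xs.
Qed.

End IrreducibleFactors.

(** * The count and the generating product as sums over subsets *)

Section GroupRingCoef.
Variables (K : comNzRingType) (gT : finGroupType) (g : gT).

Fact gcoef_is_zmod_morphism : zmod_morphism (@gcoef K gT g).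
Proof. by move=> a b; rewrite /gcoef !ffunE. Qed.
HB.instance Definition _ := GRing.isZmodMorphism.Build
  (groupRing K gT) K (@gcoef K gT g) gcoef_is_zmod_morphism.
End GroupRingCoef.

Section Generating.
Variables (K : fieldType) (F : finFieldType) (w : nat) (T : {fset nat}).
Local Notation A := (groupRing K (bracketGroup F w)).
Local Notation X := (irrIdx F T).
Local Notation fib S i := [set x in S | tag x == i].
Local Notation irrGelt S := (gelt K (bracket w (irrProd S))).

(** The signed weight of [S] in the inclusion-exclusion. *)
Definition sbinProd (r : T -> nat) (S : {set X}) : int :=
  \prod_(i : T) sbin #|fib S i| (r i).

Lemma countNE m (r : T -> nat) (g0 : bracketGroup F w) :
  (countN m r g0)%:R =
  \sum_(S : {set X} | (irrDeg S <= m)%N)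
     gcoef g0 (irrGelt S * classSum F w K (m - irrDeg S)) *~ sbinProd r S.
Proof.
rewrite /countN -sum1_size -big_fset_condE natr_sum big_mkcond /=.
(* The class condition on [g] becomes the coefficient of [g0] in the class of [g], and the condition
   on its factors becomes a sum over the [S] with [irrProd S %| g]. *)
transitivity (\sum_(g <- monics F m) \sum_(S : {set X} | irrProd S %| g)
    gcoef g0 (gelt K (bracket w g)) *~ sbinProd r S).
  apply: eq_bigr => g _; under eq_bigl do rewrite irrProd_dvd.
  rewrite -mulrz_sumr sum_subset_sbin.
  have -> : [forall i : T, #|fib [set x : X | irrPoly x %| g] i| == r i] =
      [forall i : T, #|` [fset p in irreds F (val i) | p %| g]%fset| == r i].
    apply: eq_forallb => i; rewrite -(card_irrIdx (fun p => p %| g)).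
    by congr (_ == _); apply: eq_card => x; rewrite !inE.
  rewrite /gcoef ffunE eq_sym.
  by case: (_ == _); case: [forall _, _]; rewrite ?mulr0n ?mul0rz ?mulr0z.
rewrite (exchange_big_dep predT) //= [RHS]big_mkcond /=.
apply: eq_bigr => S _; have := irrProd_monics S => SD.
rewrite -mulrz_suml -raddf_sum (sum_dvd_monics _ _ SD).
case: ifP => _; last by rewrite raddf0 mul0rz.
congr (_ *~ _); congr gcoef; rewrite /classSum mulr_sumr big_seq [RHS]big_seq.
apply: eq_bigr => h; rewrite in_monics => /andP[hm _].
have : irrProd S \is monic by move: SD; rewrite in_monics => /andP[].
by move=> Sm; rewrite bracketM // gelt_mul.
Qed.

Lemma zuconst_sum (J : Type) (s : seq J) (Q : pred J) (G : J -> A) :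
  zuconst T (\sum_(j <- s | Q j) G j) = \sum_(j <- s | Q j) zuconst T (G j).
Proof. exact: (raddf_sum (mkmalgU mone)). Qed.

Lemma gelt_irrProd (S : {set X}) :
  irrGelt S = \prod_(x in S) gelt K (bracket w (irrPoly x)).
Proof.
(* Monicity is carried through the induction because [bracketM] holds for monic factors. *)
rewrite /irrProd; suff [_ ->] : \prod_(x in S) irrPoly x \is monic /\
    gelt K (bracket w (\prod_(x in S) irrPoly x)) =
    \prod_(x in S) gelt K (bracket w (irrPoly x)) by [].
elim/big_rec2: _ => [|x a p _ [pm pE]].
  split; [exact: monic1 | congr (gelt K)].
  (* The class of 1 is idempotent, hence the identity of the group. *)
  apply: (mulgI (bracket w 1)).
  by rewrite -(bracketM w (monic1 F) (monic1 F)) mulr1 mulg1.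
have [xm _ _] := irrPolyP x.
by rewrite monicMl // bracketM // gelt_mul pE.
Qed.

Lemma prod_irrTerm (S : {set X}) :
  \prod_(x in S)
     (zuconst T (gelt K (bracket w (irrPoly x))) * zvar A T ^+ val (tag x) *
      (uvar A (tag x) - 1)) =
  zuconst T (irrGelt S) * zvar A T ^+ irrDeg S *
     \prod_(i : T) (uvar A i - 1) ^+ #|fib S i|.
Proof.
have e1 : \prod_(x in S) zuconst T (gelt K (bracket w (irrPoly x))) =
    zuconst T (irrGelt S).
  rewrite gelt_irrProd; apply: esym.
  exact: (big_morph _ (@zuconstM A T) (@zuconst1 A T)).
have e2 : \prod_(x in S) zvar A T ^+ val (tag x) = zvar A T ^+ irrDeg S.
  by rewrite /irrDeg expr_sum.
have e3 : \prod_(x in S) (uvar A (tag x) - 1) =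
    \prod_(i : T) (uvar A i - 1) ^+ #|fib S i|.
  rewrite (partition_big (fun x : X => tag x) predT) //=.
  apply: eq_bigr => i _; rewrite -prodr_const.
  by apply: eq_big => [x|x /andP[_ /eqP->]]; rewrite ?inE.
by rewrite big_split big_split /= e1 e2 e3.
Qed.

Lemma prod_irreds :
  \prod_(i : T) \prod_(g <- irreds F (val i))
     (1 + zuconst T (gelt K (bracket w g)) * zvar A T ^+ val i *
            (uvar A i - 1)) =
  \sum_(S : {set X}) zuconst T (irrGelt S) * zvar A T ^+ irrDeg S *
     \prod_(i : T) (uvar A i - 1) ^+ #|fib S i|.
Proof.
under eq_bigr do rewrite big_seq_fsetE /=.
rewrite sig_big_dep /=.
under eq_bigr do rewrite addrC.
rewrite bigA_distr; apply: eq_bigr => S _; rewrite -big_mkcond /=.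
exact: prod_irrTerm.
Qed.

(** In the term of [S] the exponent of [z] forces [d = m - irrDeg S]; the range of [d] gives the two
    conditions on [S]. *)
Lemma zucoef_J m (r : T -> nat) :
  zucoef (zumonom m r)
    (zuconst T (idempJ K F w) *
     (\sum_(0 <= d < w) \sum_(h <- monics F d)
         zuconst T (gelt K (bracket w h)) * zvar A T ^+ d) *
     \prod_(i : T) \prod_(g <- irreds F (val i))
       (1 + zuconst T (gelt K (bracket w g)) * zvar A T ^+ val i *
            (uvar A i - 1))) =
  \sum_(S : {set X} | (irrDeg S <= m)%N && (m - irrDeg S < w)%N)
    (idempJ K F w * classSum F w K (m - irrDeg S) * irrGelt S) *~ sbinProd r S.
Proof.
have JE : zuconst T (idempJ K F w) *
    (\sum_(0 <= d < w) \sum_(h <- monics F d)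
       zuconst T (gelt K (bracket w h)) * zvar A T ^+ d) =
    \sum_(0 <= d < w)
       zuconst T (idempJ K F w * classSum F w K d) * zvar A T ^+ d.
  rewrite [LHS]mulr_sumr; apply: eq_bigr => d _.
  by rewrite zuconstM -[RHS]mulrA zuconst_sum [in RHS]mulr_suml.
have termE d (S : {set X}) :
    zucoef (zumonom m r)
      (zuconst T (idempJ K F w * classSum F w K d) * zvar A T ^+ d *
       (zuconst T (irrGelt S) * zvar A T ^+ irrDeg S *
        \prod_(i : T) (uvar A i - 1) ^+ #|fib S i|)) =
    (idempJ K F w * classSum F w K d * irrGelt S) *~ sbinProd r S
      *+ (d + irrDeg S == m).
  by rewrite zutermM zucoef_sub1.
apply: etrans (congr1 (zucoef _) (congr2 *%R JE prod_irreds)) _.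
rewrite [X in zucoef _ X]mulr_suml zucoef_sum.
under eq_bigr => d _.
  rewrite [X in zucoef _ X]mulr_sumr zucoef_sum.
  under eq_bigr do rewrite termE.
  over.
rewrite exchange_big /= [RHS]big_mkcond /=; apply: eq_bigr => S _.
case: (leqP (irrDeg S) m) => [dm|md] /=; last first.
  rewrite big1 // => d _; have -> : (d + irrDeg S == m) = false by lia.
  by rewrite mulr0n.
have dE d : (d + irrDeg S == m) = (d == m - irrDeg S)%N by lia.
under eq_bigr do rewrite dE.
rewrite big_mkord; case: (ltnP (m - irrDeg S) w) => dw.
  rewrite (bigD1 (Ordinal dw)) //= eqxx mulr1n big1 ?addr0 // => d dn.
  by rewrite -[_ == _ :> nat]/(d == Ordinal dw) (negPf dn).
rewrite big1 // => d _; have -> : (d == m - irrDeg S :> nat)%N = false.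
  by have := ltn_ord d; lia.
by rewrite mulr0n.
Qed.

End Generating.

(** * Separating the contributions of [idempE] and [idempJ] *)

Lemma countN_field (K : fieldType) (F : finFieldType) (w : nat) (T : {fset nat})
    (g0 : bracketGroup F w) (m : nat) (r : T -> nat) :
  #|F|%:R != 0 :> K ->
  (countN m r g0)%:R =
    #|F|%:R ^ (m%:Z - w%:Z) *
      (\sum_(j : {dffun forall i : T, 'I_(#|` irreds F (val i)|.+1 - r i)})
         (\sum_(i : T) val i * (r i + j i) <= m)%N%:R *
         \prod_(i : T)
           ('C(#|` irreds F (val i)|, r i)%:R *
            #|F|%:R ^- (val i * r i) * #|F|%:R ^- (val i * j i) *
            'C(#|` irreds F (val i)| - r i, j i)%:R * (-1) ^+ j i))
    + gcoef g0 (\sum_(S : {set irrIdx F T} |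
                      (irrDeg S <= m)%N && (m - irrDeg S < w)%N)
        (idempJ K F w * classSum F w K (m - irrDeg S) *
           gelt K (bracket w (irrProd S))) *~ sbinProd r S).
Proof.
set q : K := #|F|%:R => q0; rewrite countNE.
have rE (a b c d s : K) : a * b * c * d * s = b * c * (a * d * s) by ring.
(* The cutoff at [m] and the power of [q] depend on [S] only through its degree, the form that
   [sum_sbin_draws] accepts. *)
pose G n : K := (n <= m)%N%:R * q ^- n.
have cardX i : #|[set x : irrIdx F T | tag x == i]| = #|` irreds F (val i)|.
  rewrite (card_irrIdx predT); congr #|` _|.
  by apply/fsetP => p; rewrite !inE /= andbT.
have -> : \sum_(j : {dffun forall i : T, 'I_(#|` irreds F (val i)|.+1 - r i)})
      (\sum_(i : T) val i * (r i + j i) <= m)%N%:R *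
      \prod_(i : T)
        ('C(#|` irreds F (val i)|, r i)%:R * q ^- (val i * r i) *
         q ^- (val i * j i) *
         'C(#|` irreds F (val i)| - r i, j i)%:R * (-1) ^+ j i) =
    \sum_(S : {set irrIdx F T}) G (irrDeg S) * (sbinProd r S)%:~R.
  under [RHS]eq_bigr do rewrite irrDegE.
  rewrite [RHS](sum_sbin_draws _ _ _ cardX) /=; apply: eq_bigr => j _.
  rewrite /G -[RHS]mulrA; congr (_ * _).
  rewrite expr_sum -prodfV -big_split; apply: eq_bigr => i _ /=.
  rewrite mulnDr exprD invfM. exact: rE.
rewrite raddf_sum mulr_sumr [X in _ = X + _](bigID (fun S => irrDeg S <= m)%N) /=.
rewrite [X in _ = _ + X + _]big1 ?addr0; last first.
  by move=> S /negPf md; rewrite /G md mul0r mul0r mulr0.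
rewrite [X in _ = _ + X]big_mkcondr -big_split; apply: eq_bigr => S Sm /=.
(* The exponent [m - w] may be negative, so the powers of [q] are combined with integer
   exponents. *)
have -> : q ^ (m%:Z - w%:Z) * (G (irrDeg S) * (sbinProd r S)%:~R) =
    q ^+ (m - irrDeg S) / q ^+ w *~ sbinProd r S.
  rewrite /G Sm mul1r -[RHS]mulrzr [LHS]mulrA; congr (_ * _).
  by rewrite expfzDr // -exprnN -exprnP expfB_cond ?(negPf q0) // mulrAC.
rewrite [in LHS](classSumE w q0) [gelt _ _ * _]mulrDr raddfD mulrzDl; congr (_ + _).
  (* [idempE] absorbs the class of [irrProd S], and each of its coefficients is the inverse of
     [q ^+ w]. *)
  rewrite mulrC mulrnAl idempE_gelt raddfMn /= gcoef_idempE.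
  by congr (_ *~ _); rewrite -[LHS]mulr_natl natrX.
case: ifP => _; last by rewrite mulr0 raddf0 mul0rz.
by rewrite [gelt _ _ * _]mulrC raddfMz.
Qed.

Theorem theorem1 (R : realType) (F : finFieldType) (w : nat) (T : {fset nat})
    (hT : 0%N \notin T) (f : {poly F}) (hf : f \is monic) (m : nat)
    (r : T -> nat) :
  let q : R[i] := #|F|%:R in
  let I (i : T) : {fset {poly F}} := irreds F (val i) in
  let c (g : bracketGroup F w) : zuPoly (groupRing R[i] (bracketGroup F w)) T :=
    zuconst T (gelt R[i] g) in
  let z : zuPoly (groupRing R[i] (bracketGroup F w)) T := zvar _ T in
  let u (i : T) : zuPoly (groupRing R[i] (bracketGroup F w)) T := uvar _ i in
  (countN m r (bracket w f))%:R =
    q ^ (m%:Z - w%:Z) *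
      (\sum_(j : {dffun forall i : T, 'I_(#|` I i|.+1 - r i)})
         (\sum_(i : T) val i * (r i + j i) <= m)%N%:R *
         \prod_(i : T)
           ('C(#|` I i|, r i)%:R * q ^- (val i * r i) * q ^- (val i * j i) *
            'C(#|` I i| - r i, j i)%:R * (-1) ^+ j i))
    + gcoef (bracket w f) (zucoef (zumonom m r)
        (zuconst T (idempJ R[i] F w) *
         (\sum_(0 <= d < w) \sum_(h <- monics F d) c (bracket w h) * z ^+ d) *
         \prod_(i : T) \prod_(g <- I i)
            (1 + c (bracket w g) * z ^+ val i * (u i - 1)))).
Proof.
move=> q I c z u; have q0 : q != 0.
  by rewrite Num.Theory.pnatr_eq0 -lt0n; apply/card_gt0P; exists 0.
rewrite zucoef_J; exact: (countN_field (bracket w f) m r q0).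
Qed.
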